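(* Let $G$ and $G'$ be graphs and $k\ge2$. Suppose that: (a1) $\Delta G\ge k$ and $G\in\mathcal{G}_{\bowtie}$; (a2) $\Delta(G\setminus x)\ge k$ and $G\setminus x\in\mathcal{G}_{\bowtie}$ for every vertex $x$ in $G$ except for one vertex $v$; (a3) if $p$ is a loop in $G$, then $p$ is incident to $v$; (a4) $v$ is not a $k$-big vertex of $G$ (i.e. $s(v,G)\le\rho^*_k(G)+1$) and $G\setminus v$ has no tree component; and (a5) $M_k(G')=M_k(G)$. Then $\mathcal{S}(G)=\mathcal{S}(G')$, i.e. $G$ and $G'$ are strongly isomorphic.
   Context: Graphs are finite and may have loops and parallel edges. For $X\subseteq E(G)$, $G\langle X\rangle$ is the subgraph of $G$ induced by $X$, i.e. with edge set $X$ and whose vertices are the end-vertices of edges in $X$. $\Delta G=|E(G)|-|V(G)|$. $\mathcal{G}_{\bowtie}$ is the set of graphs having no isolated vertices, no leaves (vertices of degree 1, a loop contributing 2 to the degree), and no cycle components (components that are cycles; a vertex with a single loop is a cycle, and two parallel edges form a cycle). For $k\ge1$ the $k$-circular matroid $M_k(G)$ is the matroid on $E(G)$ whose circuits are the sets $C\subseteq E(G)$ with $\Delta G\langle C\rangle=k$ and $G\langle C\rangle\in\mathcal{G}_{\bowtie}$ (these are known to be the circuits of a matroid). $\rho^*_k(G)$ is the corank of $M_k(G)$, i.e. $|E(G)|$ minus the rank of $M_k(G)$. Equality $M_k(G)=M_k(G')$ means equality of ground sets $E(G)=E(G')$ and of the families of circuits. $G\setminus x$ is $G$ with vertex $x$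 and all edges incident to it deleted. A tree component is a component that is a tree; an isolated vertex counts as a tree. $S(x,G)$ is the set of edges of $G$ incident to $x$ (loops included), $s(x,G)=|S(x,G)|$, and $\mathcal{S}(G)=\{S(x,G):x\in V(G)\}$. A vertex $x$ of $G$ is $k$-big if $s(x,G)>\rho^*_k(G)+1$. Graphs $G=(V,E,\phi)$ and $G'=(V',E,\phi')$ with the same edge set are strongly isomorphic if there is a bijection $\nu:V\to V'$ such that for each edge $e$: $\phi(e)=\{x,y\}\Leftrightarrow\phi'(e)=\{\nu(x),\nu(y)\}$, where $\phi(e)$ is the set of end-vertices of $e$.
   Formalization: The formal theorem additionally assumes that G' has no isolated vertices; without this the claim fails, since adding an isolated vertex to G leaves M_k(G) unchanged but changes S(G). *)

(* Defs.v *)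
From mathcomp Require Import all_boot all_order all_algebra.

Set Implicit Arguments.
Unset Strict Implicit.
Unset Printing Implicit Defensive.

Import Order.TTheory GRing.Theory Num.Theory.

(* The vertex and edge sets are finite subsets of ambient finite types, so that
   subgraphs stay in the same type and the edge sets of two graphs can be
   compared.  The values of [ends] outside [edges] are irrelevant.  An edge is a
   loop when its set of end-vertices is a singleton; parallel edges are distinct
   edges with equal [ends]. *)
Record graph (V E : finType) := Graph {
  vertices : {set V};
  edges : {set E};
  ends : E -> {set V};
  ends_vertices : forall e, e \in edges -> ends e \subset vertices;
  ends_card : forall e, e \in edges -> 0 < #|ends e| <= 2 }.

Section Graphs.
Variables V E : finType.
Implicit Types (G : graph V E) (x y : V) (A : {set V}) (X C : {set E}).

Definition is_loop G (e : E) : bool := (e \in edges G) && (#|ends G e| == 1).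

Definition star G x : {set E} := [set e in edges G | x \in ends G e].

Definition stars G : {set {set E}} := [set star G x | x in vertices G].

Definition deg G x : nat :=
  #|star G x| + #|[set e in edges G | ends G e == [set x]]|.

Definition isolated G x : bool := (x \in vertices G) && (deg G x == 0).

Definition leaf G x : bool := (x \in vertices G) && (deg G x == 1).

Definition Delta G : int := (#|edges G|%:Z - #|vertices G|%:Z)%R.

Definition sub_edges G A X : {set E} :=
  [set e in edges G :&: X | ends G e \subset A].

Lemma sub_ends_vertices G A X e :
  e \in sub_edges G A X -> ends G e \subset vertices G :&: A.
Proof.
by rewrite !inE subsetI => /andP[/andP[eG _] ->]; rewrite ends_vertices.
Qed.

Lemma sub_ends_card G A X e :
  e \in sub_edges G A X -> 0 < #|ends G e| <= 2.
Proof. by rewrite !inE => /andP[/andP[eG _] _]; exact: ends_card. Qed.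

(* The subgraph with vertex set V(G) :&: A whose edges are the edges of G that
   belong to X and have all their ends in A. *)
Definition subgraph G A X : graph V E :=
  Graph (@sub_ends_vertices G A X) (@sub_ends_card G A X).

(* G<X> *)
Definition edge_induced G X : graph V E :=
  subgraph G (\bigcup_(e in edges G :&: X) ends G e) X.

(* G \ x *)
Definition del_vertex G x : graph V E := subgraph G (~: [set x]) setT.

Definition adj G : rel V :=
  fun x y => [exists e in edges G, ends G e == [set x; y]].

Definition connected G : bool :=
  (vertices G != set0) &&
  [forall x in vertices G, forall y in vertices G, connect (adj G) x y].

Definition component G x : graph V E :=
  subgraph G [set y | connect (adj G) x y] setT.

(* A single vertex with one loop and a pair of parallel edges are cycles. *)
Definition is_cycle G : bool :=
  connected G && [forall x in vertices G, deg G x == 2].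

Definition is_tree G : bool :=
  connected G &&
  [forall X : {set E}, (X \subset edges G) ==> ~~ is_cycle (edge_induced G X)].

Definition has_tree_component G : bool :=
  [exists x in vertices G, is_tree (component G x)].

Definition has_cycle_component G : bool :=
  [exists x in vertices G, is_cycle (component G x)].

Definition bowtie G : bool :=
  [&& ~~ [exists x, isolated G x], ~~ [exists x, leaf G x]
    & ~~ has_cycle_component G].

End Graphs.

(* A matroid presented by its ground set and its family of circuits.  The circuit
   axioms are not part of the record, so Leibniz equality is exactly equality
   of the ground sets and of the families of circuits. *)
Record circuit_system (E : finType) := CircuitSystem {
  ground : {set E};
  circuits : {set {set E}} }.

Section Matroids.
Variable E : finType.
Implicit Types (M : circuit_system E) (X C : {set E}).

Definition indep M X : bool :=
  (X \subset ground M) && [forall C in circuits M, ~~ (C \subset X)].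

Definition rank M : nat := \max_(X : {set E} | indep M X) #|X|.

Definition corank M : nat := #|ground M| - rank M.

End Matroids.

Section Circular.
Variables V E : finType.
Implicit Types (k : nat) (G : graph V E).

Definition circular_matroid k G : circuit_system E :=
  CircuitSystem (edges G)
    [set C : {set E} | [&& C \subset edges G,
                           Delta (edge_induced G C) == k%:Z%R
                         & bowtie (edge_induced G C)]].

Definition big_vertex k G (x : V) : bool :=
  corank (circular_matroid k G) + 1 < #|star G x|.

End Circular.

Definition strongly_isomorphic (V V' E : finType)
    (G : graph V E) (G' : graph V' E) : Prop :=
  edges G = edges G' /\
  exists nu : {x | x \in vertices G} -> {x' | x' \in vertices G'},
    bijective nu /\
    forall (e : E) (x y : {x | x \in vertices G}), e \in edges G ->
      (ends G e = [set val x; val y] <->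
       ends G' e = [set val (nu x); val (nu y)]).

(* Main.v *)
Require Import Defs.
From mathcomp Require Import all_boot all_order all_algebra.
From mathcomp Require Import zify.

Set Implicit Arguments.
Unset Strict Implicit.
Unset Printing Implicit Defensive.

(** A graph is in the class [bowtie] iff every nonempty vertex set U meets more than
    |U| edges; from this Hall-type condition the circuits of M_k(G) are the minimal
    edge sets X spanning at most |X| - k vertices, and an edge set that spans n
    vertices, satisfies the weak Hall condition and has at least n + k - 1 edges
    has rank n + k - 1.  Hence M_k(G) = M_k(G') forces |V(G)| = |V(G')|.  For x <> v,
    E - S(x) is a union of circuits, so in G' it spans at most |V| - 1 vertices and
    thus avoids a star S'(x'); adding any edge of S(x) to E - S(x) gives a set of full
    rank, so S'(x') = S(x).  One vertex v' of G' remains.  An edge of G missing v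
    is no loop, so both its ends in G' are already known and differ from v':
    S'(v') is contained in S(v).  Since G \ v has no tree component and v is not
    k-big, the same rank argument gives S'(v') = S(v). *)

(** * Hall-type conditions on edge sets and sparse subsets *)

Section Hall.
Variables V E : finType.
Implicit Types (G H : graph V E) (U A : {set V}) (X Y B : {set E}).

Definition endset G X : {set V} := \bigcup_(e in X) ends G e.

Definition meeting G X U : {set E} := [set e in X | ends G e :&: U != set0].

(* Hall's condition with surplus d: d = 1 characterises the class [bowtie], d = 0 the
   absence of tree components. *)
Definition hall G d X A : Prop :=
  forall U, U \subset A -> U != set0 -> #|U| + d <= #|meeting G X U|.

Lemma ends_sub_endset G X e : e \in X -> ends G e \subset endset G X.
Proof. by move=> eX; apply: (bigcup_sup e). Qed.

Lemma endsetS G X Y : X \subset Y -> endset G X \subset endset G Y.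
Proof.
by move=> sXY; apply/bigcupsP => e eX; apply/ends_sub_endset/(subsetP sXY).
Qed.

Lemma endsetU G X Y : endset G (X :|: Y) = endset G X :|: endset G Y.
Proof. exact: bigcup_setU. Qed.

Lemma endset_vertices G X : X \subset edges G -> endset G X \subset vertices G.
Proof.
by move=> sX; apply/bigcupsP => e eX; apply/ends_vertices/(subsetP sX).
Qed.

Lemma mem_meeting G X U e x :
  e \in X -> x \in ends G e -> x \in U -> e \in meeting G X U.
Proof. by move=> eX xe xU; rewrite inE eX; apply/set0Pn; exists x; rewrite inE xe. Qed.

Lemma hallW G X A : hall G 1 X A -> hall G 0 X A.
Proof.
by move=> hX U sU n0; apply: leq_trans (hX U sU n0); rewrite leq_add2l.
Qed.

Lemma hall_incident G d X A x :
  hall G d X A -> x \in A -> d < #|[set e in X | x \in ends G e]|.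
Proof.
move=> hX xA; have := hX [set x]; rewrite sub1set cards1 add1n => h.
apply: leq_trans (h xA _) _; first by apply/set0Pn; exists x; rewrite inE.
apply/subset_leq_card/subsetP => e; rewrite !inE => /andP[-> /set0Pn[y]].
by rewrite !inE => /andP[ye /eqP <-].
Qed.

Lemma hall_sub_endset G d X A : hall G d X A -> A \subset endset G X.
Proof.
move=> hX; apply/subsetP => x xA.
have /(leq_ltn_trans (leq0n _))/card_gt0P[e] := hall_incident hX xA.
by rewrite inE => /andP[eX]; apply/subsetP/ends_sub_endset.
Qed.

(** Split U into its part inside [endset G X], served by edges of X, and the rest, served by edges
    of Y. An edge of X has no end outside [endset G X], so no edge is counted twice. *)
Lemma hallU G X Y A : hall G 0 X (endset G X) ->
  hall G 0 Y A -> hall G 0 (X :|: Y) (endset G X :|: A).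
Proof.
move=> hX hY U sU _; rewrite addn0.
set U1 := U :&: endset G X; set U2 := U :\: endset G X.
have h1 : #|U1| <= #|meeting G X U1|.
  have [->|n0] := eqVneq U1 set0; first by rewrite cards0.
  by have := hX U1 (subsetIr _ _) n0; rewrite addn0.
have h2 : #|U2| <= #|meeting G Y U2|.
  have [->|n0] := eqVneq U2 set0; first by rewrite cards0.
  have := hY U2 _ n0; rewrite addn0; apply.
  by rewrite subDset.
rewrite -(cardsID (endset G X) U); apply: leq_trans (leq_add h1 h2) _.
have dis : [disjoint meeting G X U1 & meeting G Y U2].
  apply/pred0P => e /=; apply/negP; rewrite !inE.
  move=> /andP[/andP[eX _] /andP[_ /set0Pn[x]]].
  rewrite !inE => /and3P[xe + _]; apply/negP; rewrite negbK.
  exact: (subsetP (ends_sub_endset _ eX)).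
rewrite -leq_card_setU in dis; move: dis => /eqP <-.
apply/subset_leq_card/subsetP => e; rewrite !inE.
by case/orP => /andP[-> /set0Pn[x]]; rewrite !inE ?orbT /= => h;
  apply/set0Pn; exists x; rewrite inE; case/and3P: h => *; apply/andP; split.
Qed.

(* The maximal subset on which every part Y satisfies |Y| <= |endset Y| is obtained
   greedily; tight parts (equality) are closed under union by submodularity, and
   every rejected edge has both ends in the largest tight part. *)
Lemma hall_sparse G X : hall G 0 X (endset G X) ->
  exists B, [/\ B \subset X, #|B| = #|endset G X| &
                forall Y, Y \subset B -> #|Y| <= #|endset G Y|].
Proof.
move=> hX.
pose P B := (B \subset X) &&
  [forall Y : {set E}, (Y \subset B) ==> (#|Y| <= #|endset G Y|)].
have P0 : P set0.
  rewrite /P sub0set; apply/forallP => Y; apply/implyP.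
  by rewrite subset0 => /eqP ->; rewrite cards0.
have [B maxB _] := maxset_exists P0.
have /andP[sBX /forallP sparse'] := maxsetp maxB.
have sparse Y : Y \subset B -> #|Y| <= #|endset G Y| by apply/implyP.
exists B; split=> //.
pose Q Y := (Y \subset B) && (#|Y| == #|endset G Y|).
have Q0 : Q set0 by rewrite /Q sub0set cards0 /endset big_set0 cards0.
have [T maxT _] := maxset_exists Q0.
have /andP[sTB /eqP tT] := maxsetp maxT.
have tight Y : Y \subset B -> #|Y| = #|endset G Y| -> Y \subset T.
  move=> sYB tY; have sU : Y :|: T \subset B by rewrite subUset sYB.
  suff QU : Q (Y :|: T) by rewrite -(maxsetsup maxT QU (subsetUr _ _)) subsetUl.
  rewrite /Q sU eqn_leq (sparse _ sU) /= endsetU.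
  have eqE := cardsUI Y T; have eqV := cardsUI (endset G Y) (endset G T).
  have leI : #|Y :&: T| <= #|endset G (Y :&: T)|.
    by apply: sparse; apply: subset_trans sTB; apply: subsetIr.
  have leV : #|endset G (Y :&: T)| <= #|endset G Y :&: endset G T|.
    by rewrite subset_leq_card // subsetI !endsetS ?subsetIl ?subsetIr.
  by clear -eqE eqV leI leV tY tT; lia.
have rejected e : e \in X -> e \notin B -> ends G e \subset endset G T.
  move=> eX eB; have /negP nP : ~~ P (e |: B).
    apply/negP => Pe; have := maxsetsup maxB Pe (subsetUr _ _) => eq.
    by rewrite -eq setU11 in eB.
  have [Y] : exists Y, (Y \subset e |: B) && (#|endset G Y| < #|Y|).
    apply/existsP; apply: contra_notT nP => /existsPn h.
    rewrite /P subUset sub1set eX sBX; apply/forallP => Y; apply/implyP => sY.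
    by have := h Y; rewrite sY /= -leqNgt.
  move=> /andP[sY ltY].
  have sZ : Y :\ e \subset B by rewrite subDset.
  have eY : e \in Y.
    apply: contraLR ltY => eY; rewrite -leqNgt; apply: sparse.
    by move: sZ; rewrite (setDidPl _) // disjoint_sym disjoints1.
  have sC := endsetS G (subD1set Y e).
  (* Since |Y| - 1 = |Y - e| <= |endset (Y - e)| <= |endset Y| < |Y|, equality holds throughout: Y -
     e is tight and already covers the ends of e. *)
  have [tight1 tight2] :
      #|Y :\ e| = #|endset G (Y :\ e)| /\ #|endset G (Y :\ e)| = #|endset G Y|.
    have l1 := sparse _ sZ; have l2 := subset_leq_card sC.
    move: ltY; rewrite (cardsD1 e Y) eY add1n ltnS => l3.
    by clear -l1 l2 l3; lia.
  have sZT : Y :\ e \subset T by apply: tight.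
  apply: subset_trans (endsetS G sZT).
  have /eqP -> : endset G (Y :\ e) == endset G Y by rewrite eqEcard sC tight2 leqnn.
  exact: ends_sub_endset.
apply/eqP; rewrite eqn_leq (leq_trans (sparse _ (subxx B))) ?subset_leq_card ?endsetS //=.
(* An edge of X meeting U lies in B, because rejected edges stay inside [endset G T], and outside T.
   So Hall's condition gives |U| <= |B - T|, and |T| = |endset T| supplies the remaining
   vertices. *)
set U := endset G X :\: endset G T.
have sC : endset G T \subset endset G X by apply: endsetS (subset_trans sTB sBX).
have leU : #|U| <= #|meeting G X U|.
  have [->|n0] := eqVneq U set0; first by rewrite cards0.
  by have := hX U (subsetDl _ _) n0; rewrite addn0.
have leM : #|meeting G X U| <= #|B :\: T|.
  apply/subset_leq_card/subsetP => e; rewrite !inE => /andP[eX /set0Pn[x]].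
  rewrite !inE => /and3P[xe xT _]; apply/andP; split.
    by apply: contra xT => eT; apply: (subsetP (ends_sub_endset G eT)).
  by apply: contraR xT => eB; apply: (subsetP (rejected e eX eB)).
rewrite -(cardsID (endset G T) (endset G X)) (setIidPr sC) -tT.
rewrite -(cardsID T B) (setIidPr sTB) leq_add2l.
exact: leq_trans leU leM.
Qed.

End Hall.

(** * Degree sums, components, and the Hall form of the graph conditions *)

Section Components.
Variables V E : finType.
Implicit Types (H : graph V E) (U : {set V}) (X : {set E}).

Definition edge_weight H U e :=
  \sum_(x in U) ((x \in ends H e) + (ends H e == [set x])).

Lemma sum_deg H U :
  \sum_(x in U) deg H x = \sum_(e in edges H) edge_weight H U e.
Proof.
rewrite exchange_big; apply: eq_bigr => x _; rewrite big_split /deg -!sum1_card.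
by congr (_ + _); rewrite [RHS]big_mkcond [LHS]big_mkcond;
  apply: eq_bigr => e _; rewrite !inE; do 2!case: (_ \in _) => //=; case: eqP.
Qed.

Lemma edge_weight_le2 H U e : e \in edges H ->
  edge_weight H U e <= 2 * (ends H e :&: U != set0)
    ?= iff (ends H e :&: U == set0) || (ends H e \subset U).
Proof.
move=> /ends_card /andP[e_gt0 e_le2].
(* The factor is 2 for a loop, whose single end is counted twice, and 1 for any other edge. *)
have -> : edge_weight H U e = (#|ends H e| == 1).+1 * #|ends H e :&: U|.
  rewrite mulSn /edge_weight big_split /=; congr (_ + _).
    rewrite -sum1_card big_mkcond [RHS]big_mkcond.
    by apply: eq_bigr => x _; rewrite !inE andbC; case: (_ \in U) => //; case: (_ \in _).
  have [/cards1P[a ->]|n1] := boolP (#|ends H e| == 1); last first.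
    by rewrite big1 // => x _; case: eqP => // e1; rewrite e1 cards1 in n1.
  rewrite mul1n -sum1_card big_mkcond [RHS]big_mkcond.
  apply: eq_bigr => x _; rewrite !inE (inj_eq set1_inj) eq_sym andbC.
  by case: (_ \in U) => //; case: eqP.
have [->|n0] := eqVneq (ends H e :&: U) set0.
  by rewrite cards0 muln0 /=; apply/leqif_refl.
rewrite muln1 /= (sameP setIidPl eqP) (_ : (_ == ends H e) = (#|ends H e| <= #|ends H e :&: U|)); last first.
  by rewrite eqEcard subsetIl.
move: n0 (subset_leq_card (subsetIl (ends H e) U)); rewrite -card_gt0.
move: e_gt0 e_le2; case: #|ends H e| => [|[|[|//]]] //= _ _.
  by case: #|_| => [|[|]] // _ _; apply/leqif_refl.
by case: #|_| => [|[|[|]]] // _ _; split.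
Qed.

(** Double counting of incidences. The equality case matters as much as the bound: it says that no
    edge leaves U, so that U is closed under adjacency. *)
Lemma sum_deg_le H U :
  \sum_(x in U) deg H x <= 2 * #|meeting H (edges H) U|
    ?= iff [forall (e | e \in edges H), (ends H e :&: U == set0) || (ends H e \subset U)].
Proof.
rewrite sum_deg -sum1_card big_distrr /=.
have -> : \sum_(e in meeting H (edges H) U) 2 * 1 =
          \sum_(e in edges H) 2 * (ends H e :&: U != set0).
  rewrite big_mkcond [RHS]big_mkcond; apply: eq_bigr => e _; rewrite inE.
  by case: (e \in _) => //=; case: (_ != _).
by apply: leqif_sum => e; apply: edge_weight_le2.
Qed.

Lemma connect_ends H e x y :
  e \in edges H -> x \in ends H e -> y \in ends H e -> connect (adj H) x y.
Proof.
move=> eH xe ye; have [->|nxy] := eqVneq x y; first exact: connect0.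
apply: connect1; apply/existsP; exists e; rewrite eH eq_sym eqEcard cards2 nxy.
by rewrite subUset !sub1set xe ye; case/andP: (ends_card eH).
Qed.

Lemma adj_sym H : symmetric (adj H).
Proof. by move=> x y; rewrite /adj setUC. Qed.

Lemma connect_adj_sym H : connect_sym (adj H).
Proof. exact/sym_connect_sym/adj_sym. Qed.

Lemma connect_closed H U x y :
  (forall e, e \in edges H -> ends H e :&: U != set0 -> ends H e \subset U) ->
  connect (adj H) x y -> x \in U -> y \in U.
Proof.
move=> clU cxy; rewrite -(@closed_connect _ (adj H) (mem U) _ x y) //.
move=> a b /existsP[e /andP[eH /eqP eab]].
have into c d : c \in ends H e -> d \in ends H e -> c \in U -> d \in U.
  move=> ce de cU; apply: (subsetP (clU e eH _)) de.
  by apply/set0Pn; exists c; rewrite inE ce.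
by apply/idP/idP; apply: into; rewrite eab !inE eqxx ?orbT.
Qed.

Definition reach H x : {set V} := [set y | connect (adj H) x y].

Lemma reach_closed H x e : e \in edges H ->
  ends H e :&: reach H x != set0 -> ends H e \subset reach H x.
Proof.
move=> eH /set0Pn[y]; rewrite !inE => /andP[ye cxy].
by apply/subsetP => z ze; rewrite inE (connect_trans cxy) // (connect_ends eH).
Qed.

Lemma component_connected H x : x \in vertices H -> connected (component H x).
Proof.
move=> xH; apply/andP; split.
  by apply/set0Pn; exists x; rewrite !inE xH connect0.
apply/forall_inP => a; rewrite !inE => /andP[_ xa].
apply/forall_inP => b; rewrite !inE => /andP[_ xb].
have : connect (adj H) a b by rewrite (connect_trans _ xb) // connect_adj_sym.
(* The path is retraced inside the component: each successive vertex is still reachable from x, so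
   the edge to it survives the restriction. *)
case/connectP => p; elim: p a xa => [|c p IHp] a xa /=; first by move=> _ ->.
case/andP => /existsP[e /andP[eH /eqP eac]] pcp lp.
have xc : connect (adj H) x c.
  by apply: connect_trans xa _; apply: (connect_ends eH); rewrite eac !inE eqxx ?orbT.
apply: connect_trans (IHp c xc pcp lp); apply: connect1.
apply/existsP; exists e; rewrite !inE eH /= eac eqxx andbT.
by rewrite subUset !sub1set !inE xa.
Qed.

Lemma component_edges H x :
  edges (component H x) = meeting H (edges H) (reach H x).
Proof.
apply/setP => e; rewrite !inE; case eH : (e \in edges H) => //=.
apply/idP/idP => [|/(reach_closed eH)//].
move=> /setIidPl; rewrite -/(reach H x) => ->.
by rewrite -card_gt0; case/andP: (ends_card eH).
Qed.

Lemma component_deg H x y : y \in reach H x -> deg (component H x) y = deg H y.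
Proof.
move=> xy; rewrite /deg /star component_edges.
congr (_ + _); apply: eq_card => e; rewrite !inE; case: (e \in _) => //=.
  have [ye|] := boolP (y \in ends H e); rewrite ?andbF // andbT.
  by apply/set0Pn; exists y; rewrite inE ye.
have [->|] := eqVneq (ends H e) [set y]; rewrite ?andbF // andbT.
by apply/set0Pn; exists y; rewrite !inE eqxx /=; rewrite inE in xy.
Qed.

(** If U violates Hall's condition, minimum degree 2 gives 2|U| <= (degree sum over U) <= 2|meeting
    U| <= 2|U|. Equality makes all degrees on U equal to 2 and U closed, so the component of any
    vertex of U is a cycle. Conversely, singletons give minimum degree 2, and the vertex set D of a
    cycle component would meet exactly |D| edges. *)
Lemma bowtieP H : bowtie H <-> hall H 1 (edges H) (vertices H).
Proof.
split=> [/and3P[/existsPn noiso /existsPn noleaf nocyc] U sU n0|hH].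
  rewrite addn1 ltnNge; apply: contra nocyc => leU.
  have deg_ge2 x : x \in U -> 2 <= deg H x.
    move=> /(subsetP sU) xH; have := noiso x; have := noleaf x.
    by rewrite /isolated /leaf xH; case: (deg H x) => [|[|]].
  have le1 : \sum_(x in U) 2 <= \sum_(x in U) deg H x
      ?= iff [forall (x | x \in U), 2 == deg H x].
    by apply: leqif_sum => x /deg_ge2; apply: leqif_eq.
  have [le2 eq2] := leqif_trans le1 (sum_deg_le H U).
  have : \sum_(x in U) 2 == 2 * #|meeting H (edges H) U|.
    by rewrite eqn_leq le2 /= sum_nat_const mulnC leq_mul2r leU.
  rewrite eq2 => /andP[/forall_inP deg2 /forall_inP clU].
  have [x xU] := set0Pn _ n0; apply/exists_inP; exists x; first exact: (subsetP sU).
  rewrite /is_cycle component_connected ?(subsetP sU) //=.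
  apply/forall_inP => y; rewrite !inE => /andP[_ xy].
  rewrite component_deg ?inE // eq_sym deg2 //.
  apply: connect_closed xy xU => e eH; have := clU e eH.
  by case/orP => [->|].
have deg_ge2 x : x \in vertices H -> 1 < deg H x.
  by move=> /(hall_incident hH)/leq_trans -> //; apply: leq_addr.
apply/and3P; split.
- by apply/existsPn => x; apply/andP => -[/deg_ge2]; case: (deg H x).
- by apply/existsPn => x; apply/andP => -[/deg_ge2]; case: (deg H x) => [|[]].
apply/exists_inPn => x xH; apply/andP => -[_ /forall_inP deg2].
pose D := vertices H :&: reach H x.
have nD : D != set0 by apply/set0Pn; exists x; rewrite !inE xH connect0.
have := hH D (subsetIl _ _) nD; apply/negP; rewrite addn1 -leqNgt.
have clD e : e \in edges H -> ends H e :&: D != set0 -> ends H e \subset D.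
  move=> eH meet; rewrite subsetI ends_vertices //= reach_closed //.
  by apply: contraNneq meet => m0; rewrite setIA setIAC m0 set0I.
have [_ eqD] := sum_deg_le H D.
have /eqP sumD : \sum_(y in D) deg H y == 2 * #|meeting H (edges H) D|.
  rewrite eqD; apply/forall_inP => e eH.
  by rewrite -implyNb; apply/implyP/clD.
rewrite -(leq_pmul2l (isT : 0 < 2)) -sumD mulnC -sum_nat_const.
apply: eq_leq; apply: eq_bigr => y yD.
have xy : y \in reach H x by case/setIP: yD.
by rewrite -(component_deg xy); apply/eqP/deg2.
Qed.

(* A smallest violating set U has no edge leaving it and no loop, one edge fewer
   than vertices, and no cycle, so it is the vertex set of a tree component. *)
Lemma no_tree_component_hall H :
  ~~ has_tree_component H -> hall H 0 (edges H) (vertices H).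
Proof.
move=> notree U0 sU0 n0; rewrite addn0 leqNgt; apply: contra notree => bad0.
pose bad U := (U \subset vertices H) && (#|meeting H (edges H) U| < #|U|).
have /minset_exists[U minU _] : bad U0 by rewrite /bad sU0.
have /andP[sU badU] := minsetp minU.
have good (W : {set V}) : W \subset U -> W != U -> #|W| <= #|meeting H (edges H) W|.
  move=> sW; apply: contraR; rewrite -ltnNge => badW; apply/eqP.
  by apply: (minsetinf minU) => //; rewrite /bad (subset_trans sW).
have meetS (W : {set V}) : W \subset U -> meeting H (edges H) W \subset meeting H (edges H) U.
  move=> sW; apply/subsetP => e; rewrite !inE => /andP[-> /set0Pn[y]] /=.
  by rewrite inE => /andP[ye /(subsetP sW) yU]; apply/set0Pn; exists y; rewrite inE ye.
(* By minimality U - u meets at least |U| - 1 edges, while U meets at most that many; so both meet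
   the same edges. Hence an edge with an end u in U has a second end in U. *)
have through u e : u \in U -> e \in meeting H (edges H) U ->
    e \in meeting H (edges H) (U :\ u).
  move=> uU; apply/subsetP; have nU : U :\ u != U.
    by apply: contraTneq uU => <-; rewrite setD11.
  have /eqP -> // : meeting H (edges H) U == meeting H (edges H) (U :\ u).
  rewrite eq_sym eqEcard meetS ?subD1set //=.
  apply: leq_trans (good _ (subD1set _ _) nU).
  by move: badU; rewrite (cardsD1 u) uU add1n ltnS.
have two e : e \in meeting H (edges H) U -> ends H e \subset U.
  move=> eU; have := eU; rewrite inE => /andP[eH /set0Pn[u]].
  rewrite inE => /andP[ue uU]; have := through u e uU eU.
  rewrite inE => /andP[_ /set0Pn[w]]; rewrite !inE => /and3P[we nwu wU].
  suff <- : [set u; w] = ends H e by rewrite subUset !sub1set uU.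
  apply/eqP; rewrite eqEcard subUset !sub1set ue we /= cards2 eq_sym nwu.
  by case/andP: (ends_card eH).
have clU e : e \in edges H -> ends H e :&: U != set0 -> ends H e \subset U.
  by move=> eH meet; apply: two; rewrite inE eH.
have /card_gt0P[u uU] : 0 < #|U| by apply: leq_ltn_trans badU.
have uH := subsetP sU u uU.
have reachU : reach H u = U.
  have sD : reach H u \subset U.
    by apply/subsetP => y; rewrite inE => uy; apply: connect_closed uy uU.
  (* Otherwise the reachable part and the rest of U are proper subsets, both good, and no edge meets
     both; adding their inequalities would make U good. *)
  apply/eqP; apply: contraTT badU => nD; rewrite -leqNgt.
  have nD' : U :\: reach H u != U.
    by apply: contraTneq uU => <-; rewrite !inE connect0.
  rewrite -(cardsID (reach H u) U) (setIidPr sD).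
  apply: leq_trans (leq_add (good _ sD nD) (good _ (subsetDl _ _) nD')) _.
  rewrite -cardsUI (_ : _ :&: _ = set0) ?cards0 ?addn0.
    by rewrite subset_leq_card // subUset !meetS ?subsetDl.
  apply/setP => e; rewrite in_set0; apply/negP; rewrite in_setI [in X in _ && X]inE.
  rewrite inE -andbA => /and3P[eH /(reach_closed eH) /subsetP sub /andP[_ /set0Pn[y]]].
  by rewrite in_setI in_setD => /and3P[/sub ->].
apply/exists_inP; exists u => //; rewrite /is_tree component_connected //=.
set C := component H u.
apply/forall_inP => X sX; apply/negP => /andP[/andP[nv _] /forall_inP deg2].
set K := edge_induced C X in nv deg2.
have sXC : X \subset meeting H (edges H) U by rewrite -reachU -component_edges.
(* A cycle K has at least |W| edges, none of which meets U - W. As U - W is a proper subset of U,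
   hence good, U would meet at least |U| edges. *)
pose W := vertices K.
have sWU : W \subset U.
  by rewrite /W !subIset // -/(reach H u) reachU subxx orbT.
have sKX e : e \in edges K -> e \in meeting H (edges H) U.
  by rewrite !inE => /andP[/andP[_ eX] _]; have := subsetP sXC e eX; rewrite inE.
have cardK : #|W| <= #|edges K|.
  rewrite -(leq_pmul2l (isT : 0 < 2)).
  have -> : 2 * #|W| = \sum_(x in W) deg K x.
    by rewrite mulnC -sum_nat_const; apply: eq_bigr => y /deg2/eqP.
  apply: leq_trans (sum_deg_le K W) _; rewrite leq_pmul2l // subset_leq_card //.
  by apply/subsetP => e; rewrite inE => /andP[].
have nW : U :\: W != U.
  have [y yW] := set0Pn _ nv; apply/eqP => /setP/(_ y).
  by rewrite inE yW (subsetP sWU y yW).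
have := good _ (subsetDl U W) nW; apply/negP; rewrite -ltnNge.
have disj : [disjoint edges K & meeting H (edges H) (U :\: W)].
  apply/pred0P => e /=; apply/negP => /andP[eK]; rewrite inE => /andP[_ /set0Pn[y]].
  rewrite !in_setI in_setD => /and3P[ye /negP nyW _]; apply: nyW.
  exact: (subsetP (@ends_vertices _ _ K e eK) y ye).
have le : #|edges K| + #|meeting H (edges H) (U :\: W)| < #|U|.
  rewrite -leq_card_setU in disj; rewrite -(eqP disj).
  apply: leq_ltn_trans badU; rewrite subset_leq_card // subUset meetS ?subsetDl // andbT.
  by apply/subsetP.
rewrite -(ltn_add2l #|W|) (leq_ltn_trans _ (leq_trans le _)) ?leq_add2r //.
by rewrite -(cardsID W U) (setIidPr sWU).
Qed.

End Components.

(** * Circuits and independent sets of the k-circular matroid *)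

Section Circuits.
Variables (V E : finType) (k : nat).
Hypothesis k_gt0 : 0 < k.
Implicit Types (G : graph V E) (C I X Y : {set E}).

Lemma edge_induced_edges G X : X \subset edges G -> edges (edge_induced G X) = X.
Proof.
move=> sX; rewrite /= /sub_edges (setIidPr sX); apply/setP => e; rewrite inE.
by apply: andb_idr; apply: ends_sub_endset.
Qed.

Lemma edge_induced_vertices G X :
  X \subset edges G -> vertices (edge_induced G X) = endset G X.
Proof. by move=> sX; rewrite /= (setIidPr sX) (setIidPr (endset_vertices sX)). Qed.

Lemma circuitP G C : C \in circuits (circular_matroid k G) <->
  [/\ C \subset edges G, #|C| = #|endset G C| + k & hall G 1 C (endset G C)].
Proof.
rewrite inE; split.
  case/and3P => sC; rewrite /Delta edge_induced_edges // edge_induced_vertices //.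
  move=> /eqP dC /bowtieP; rewrite edge_induced_edges // edge_induced_vertices // => hC.
  by split=> //; clear -dC; lia.
move=> [sC dC hC]; apply/and3P; split=> //.
  rewrite /Delta edge_induced_edges // edge_induced_vertices // dC.
  by clear; apply/eqP; lia.
by apply/bowtieP; rewrite edge_induced_edges // edge_induced_vertices.
Qed.

(** A minimal C with |C| >= |endset C| + k is a circuit. Strict inequality would survive the removal
    of one edge. If U met at most |U| edges, removing these would lose at least as many vertices as
    edges, again contradicting minimality. *)
Lemma exists_circuit G X : X \subset edges G -> #|endset G X| + k <= #|X| ->
  exists2 C, C \in circuits (circular_matroid k G) & C \subset X.
Proof.
move=> sX dX; pose P Y := #|endset G Y| + k <= #|Y|.
have [C minC sCX] := @minset_exists _ P X dX.
have PC := minsetp minC; exists C => //; apply/circuitP.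
split; first exact: subset_trans sX.
  have /card_gt0P[e eC] : 0 < #|C| by apply: leq_trans PC; rewrite addn_gt0 k_gt0 orbT.
  apply/eqP; rewrite eqn_leq andbC; apply/andP; split=> //.
  rewrite leqNgt; apply: contraTN eC => ltC.
  rewrite -(minsetinf minC _ (subD1set C e)) ?setD11 //.
  apply: leq_trans (_ : #|endset G C| + k <= _).
    by rewrite leq_add2r subset_leq_card // endsetS // subD1set.
  rewrite -ltnS (leq_trans ltC) // (cardsD1 e C); by case: (_ \in _).
move=> U sU n0; rewrite addn1 ltnNge; apply/negP => leU.
have [u uU] := set0Pn _ n0.
have /bigcupP[e eC ue] := subsetP sU u uU.
have eM := mem_meeting eC ue uU.
have sM : meeting G C U \subset C by apply/subsetP => f; rewrite inE => /andP[].
suff PD : P (C :\: meeting G C U).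
  by move: eC; rewrite -(minsetinf minC PD (subsetDl _ _)) inE eM.
have sCov : endset G (C :\: meeting G C U) \subset endset G C :\: U.
  apply/bigcupsP => f; rewrite inE => /andP[fM fC].
  rewrite subsetD ends_sub_endset //= -setI_eq0.
  by apply: contraR fM => meet; rewrite inE fC.
have l1 := subset_leq_card sCov.
rewrite (cardsDS sU) in l1; rewrite /P (cardsDS sM).
have l2 := subset_leq_card sU; have l3 := subset_leq_card sM.
by rewrite /P in PC; clear -l1 l2 l3 leU PC; lia.
Qed.

Lemma indep_card G I :
  indep (circular_matroid k G) I -> #|I| < #|endset G I| + k.
Proof.
move=> /andP[sI /forall_inP free]; rewrite ltnNge; apply/negP => /(exists_circuit sI).
by case=> C /free/negP.
Qed.

Lemma sparse_indep G I : I \subset edges G ->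
  (forall Y, Y \subset I -> #|Y| < #|endset G Y| + k) ->
  indep (circular_matroid k G) I.
Proof.
move=> sI sparse; apply/andP; split=> //.
apply/forall_inP => C /circuitP[_ dC _]; apply/negP => /sparse.
by rewrite dC ltnn.
Qed.

(* A set on which |Y| <= |endset Y| for every part Y stays independent after adding
   any k - 1 edges. *)
Lemma hall_indep G X : X \subset edges G -> hall G 0 X (endset G X) ->
  exists I, [/\ I \subset X, indep (circular_matroid k G) I &
                minn #|X| (#|endset G X| + k.-1) <= #|I|].
Proof.
move=> sX /hall_sparse[B [sBX cardB sparse]].
have : minn #|X :\: B| k.-1 <= #|X :\: B| by apply: geq_minl.
case/card_geqP => s [us sz_s sub_s]; pose K : {set E} := [set e in s].
have sK : K \subset X :\: B by apply/subsetP => e; rewrite inE; apply: sub_s.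
have cardK : #|K| = minn #|X :\: B| k.-1.
  by rewrite -sz_s -(card_uniqP us); apply: eq_card => e; rewrite inE.
have sIX : B :|: K \subset X.
  by rewrite subUset sBX (subset_trans sK) ?subsetDl.
exists (B :|: K); split=> //.
  apply: sparse_indep => [|Y sY]; first exact: subset_trans sX.
  rewrite -(cardsID B Y) (leq_ltn_trans (leq_add (sparse _ (subsetIr _ _)) (leqnn _))) //.
  rewrite -addnS leq_add ?subset_leq_card ?endsetS ?subsetIl //.
  have : #|Y :\: B| <= #|K| by rewrite subset_leq_card // subDset.
  by rewrite cardK => /leq_ltn_trans; apply; rewrite -(prednK k_gt0) ltnS geq_minr.
have : [disjoint B & K].
  by rewrite disjoint_sym; apply: disjointWl sK _; rewrite -setI_eq0 setIDAC setDIl setDv setI0.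
rewrite -leq_card_setU => /eqP ->; rewrite cardK cardsDS // -cardB.
by have := subset_leq_card sBX; clear; lia.
Qed.

(** The surplus 1 pays for the loss of e: X - e still spans the same vertices and satisfies the weak
    Hall condition, so it contains an independent I with at least |endset X| + k - 1 edges. Then I +
    e is too large to be independent, and a circuit in it must use e. *)
Lemma hall_mem_circuit G X e : X \subset edges G -> hall G 1 X (endset G X) ->
  #|endset G X| + k <= #|X| -> e \in X ->
  exists C, [/\ C \in circuits (circular_matroid k G), e \in C & C \subset X].
Proof.
move=> sX hX dX eX.
have hXe : hall G 0 (X :\ e) (endset G X).
  move=> U sU n0; rewrite addn0 -ltnS -addn1; apply: leq_trans (hX U sU n0) _.
  rewrite (cardsD1 e); case: (_ \in _); rewrite ?add1n ?ltnS.
    by rewrite subset_leq_card //; apply/subsetP => f; rewrite !inE => /and3P[-> -> ->].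
  apply: leqW; rewrite subset_leq_card //; apply/subsetP => f; rewrite !inE.
  by move=> /and3P[-> -> ->].
have endsetXe : endset G (X :\ e) = endset G X.
  by apply/eqP; rewrite eqEsubset (hall_sub_endset hXe) endsetS // subD1set.
rewrite -endsetXe in hXe.
have sXe : X :\ e \subset edges G := subset_trans (subD1set X e) sX.
have [I [sI indI cardI]] := hall_indep sXe hXe.
have eI : e \notin I by apply: contraTN isT => /(subsetP sI); rewrite setD11.
have sIe : e |: I \subset X.
  by rewrite subUset sub1set eX (subset_trans sI) // subD1set.
have dI : #|endset G (e |: I)| + k <= #|e |: I|.
  rewrite cardsU1 eI; have l1 := subset_leq_card (endsetS G sIe).
  move: dX cardI; rewrite endsetXe (cardsD1 e X) eX => dX cardI.
  by clear -dX cardI l1 k_gt0; lia.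
have [C cC sC] := exists_circuit (subset_trans sIe sX) dI.
exists C; split=> //; last exact: subset_trans sIe.
have /andP[_ /forall_inP/(_ C cC)] := indI; apply: contraR => eC.
by apply/subsetP => f fC; have := subsetP sC f fC; rewrite !inE;
  case: eqP => // fe; rewrite fe in fC; rewrite fC in eC.
Qed.

(** The hypothesis refers to the matroid alone, so the weak Hall condition can be derived in any
    graph representing it. It holds for circuits and passes to unions by [hallU]. *)
Lemma circuits_union_hall G X :
  (forall e, e \in X -> exists C,
     [/\ C \in circuits (circular_matroid k G), e \in C & C \subset X]) ->
  hall G 0 X (endset G X).
Proof.
move=> cX.
have -> : X = \bigcup_(C in circuits (circular_matroid k G) | C \subset X) C.
  apply/eqP; rewrite eqEsubset; apply/andP; split; last by apply/bigcupsP => C /andP[].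
  apply/subsetP => e /cX[C [cC eC sC]]; apply/bigcupP; exists C => //.
  by rewrite cC.
apply: (big_ind (fun Y => hall G 0 Y (endset G Y))).
- by move=> U; rewrite /endset big_set0 subset0 => /eqP ->; rewrite eqxx.
- by move=> Y Z hY hZ; rewrite endsetU; apply: hallU.
by move=> C /andP[/circuitP[_ _ hC] _]; apply: hallW.
Qed.

Lemma del_vertex_edges G x : edges (del_vertex G x) = edges G :\: star G x.
Proof.
apply/setP => e; rewrite !inE andbT; case: (e \in edges G) => //=.
by rewrite andbT subsetC sub1set inE.
Qed.

Lemma del_vertex_vertices G x : vertices (del_vertex G x) = vertices G :\ x.
Proof. by rewrite /= setDE. Qed.

(** The edge e serves x and the edges avoiding x serve the other vertices, so the weak Hall
    condition extends to all of G. The [.+2] is the exact slack: one unit comes from adding e, the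
    other from the rank being |V| + k - 1 rather than |V| + k. *)
Lemma star_complement_indep G x e : x \in vertices G ->
  hall G 0 (edges G :\: star G x) (vertices G :\ x) ->
  #|vertices G| + k <= #|edges G :\: star G x|.+2 -> e \in star G x ->
  exists I, [/\ I \subset e |: (edges G :\: star G x),
                indep (circular_matroid k G) I & #|vertices G| + k.-1 <= #|I|].
Proof.
move=> xG hX dX ex; set X := edges G :\: star G x in hX dX *.
have /[!inE] /andP[eG xe] := ex.
have sXe : e |: X \subset edges G by rewrite subUset sub1set eG subsetDl.
have endsetXe : endset G (e |: X) = vertices G.
  apply/eqP; rewrite eqEsubset endset_vertices //=; apply/subsetP => y yG.
  have [->|nyx] := eqVneq y x; first by apply: (subsetP (ends_sub_endset G (setU11 e X))).
  apply: (subsetP (endsetS G (subsetUr [set e] X))).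
  by apply: (subsetP (hall_sub_endset hX)); rewrite !inE nyx.
have eX : e \notin X by rewrite inE ex.
have hXe : hall G 0 (e |: X) (endset G (e |: X)).
  rewrite endsetXe => U sU n0; rewrite addn0.
  have le : #|U :\ x| <= #|meeting G X (U :\ x)|.
    have [->|n1] := eqVneq (U :\ x) set0; first by rewrite cards0.
    by have := hX _ (setSD [set x] sU) n1; rewrite addn0.
  have sM : meeting G X (U :\ x) \subset meeting G (e |: X) U :\ e.
    apply/subsetP => f; rewrite inE => /andP[fX /set0Pn[y]].
    rewrite in_setI in_setD1 => /and3P[yf _ yU]; rewrite in_setD1.
    rewrite (mem_meeting (setU1r e fX) yf yU) andbT.
    by apply: contraNneq eX => <-.
  rewrite (cardsD1 x U) (cardsD1 e (meeting _ _ _)).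
  apply: leq_add (leq_trans le (subset_leq_card sM)).
  by case xU: (x \in U) => //; rewrite (mem_meeting (setU11 e X) xe xU).
have [I [sI indI cardI]] := hall_indep sXe hXe.
exists I; split=> //; apply: leq_trans cardI; rewrite endsetXe cardsU1 eX.
by clear -dX k_gt0; lia.
Qed.

End Circuits.

(** * Two graphs with the same k-circular matroid *)

Section Comparison.
Variables (V V' E : finType) (G : graph V E) (G' : graph V' E) (k : nat).
Hypotheses (k_gt0 : 0 < k) (eqM : circular_matroid k G' = circular_matroid k G).

Lemma eq_edges : edges G' = edges G.
Proof. by case: eqM. Qed.

(** X is a union of circuits of the common matroid, so in G' it contains an independent set with
    min(|X|, |endset G' X| + k - 1) edges. In G such a set has at most |endset G X| + k - 1 < |X|
    edges, so the minimum is its second term. *)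
Lemma endset_card_le (X : {set E}) : X \subset edges G -> hall G 1 X (endset G X) ->
  #|endset G X| + k <= #|X| -> #|endset G' X| <= #|endset G X|.
Proof.
move=> sX hX dX.
have hX' : hall G' 0 X (endset G' X).
  apply: (@circuits_union_hall _ _ k) => e eX; rewrite eqM.
  exact: hall_mem_circuit.
have sX' : X \subset edges G' by rewrite eq_edges.
have [I [sI indI cardI]] := hall_indep k_gt0 sX' hX'; rewrite eqM in indI.
have l1 := indep_card k_gt0 indI; have l2 := subset_leq_card (endsetS G sI).
by clear -dX cardI l1 l2 k_gt0; lia.
Qed.

Lemma vertices_card_le : endset G (edges G) = vertices G ->
  hall G 1 (edges G) (vertices G) -> #|vertices G| + k <= #|edges G| ->
  #|vertices G| <= #|vertices G'|.
Proof.
move=> endG hG dG.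
have hG0 : hall G 0 (edges G) (endset G (edges G)).
  by rewrite endG; apply: hallW.
have [I [sI indI cardI]] := hall_indep k_gt0 (subxx _) hG0.
rewrite -eqM in indI; rewrite endG in cardI.
have l1 := indep_card k_gt0 indI.
have /andP[sI' _] := indI; have l2 := subset_leq_card (endset_vertices sI').
by clear -dG cardI l1 l2 k_gt0; lia.
Qed.

(* If e is at x but not at x', then G has an independent set of full rank inside
   (G \ x) + e, whereas in G' that edge set avoids x'. *)
Lemma star_eq x x' : #|vertices G'| = #|vertices G| ->
  x \in vertices G -> x' \in vertices G' ->
  hall G 0 (edges G :\: star G x) (vertices G :\ x) ->
  #|vertices G| + k <= #|edges G :\: star G x|.+2 ->
  star G' x' \subset star G x -> star G' x' = star G x.
Proof.
move=> eqV xG xG' hX dX sS; apply/eqP; rewrite eqEsubset sS.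
apply/subsetP => e ex; apply: contraT => ex'.
have [I [sI indI cardI]] := star_complement_indep k_gt0 xG hX dX ex.
rewrite -eqM in indI; have l1 := indep_card k_gt0 indI.
have sC : endset G' I \subset vertices G' :\ x'.
  rewrite subsetD1 endset_vertices; last by case/andP: indI.
  apply/bigcupP => -[f /(subsetP sI) fX xf].
  have fS : f \notin star G' x'.
    by move: fX; rewrite in_setU1 => /predU1P[-> //|/setDP[_]]; apply/contra/subsetP.
  case/negP: fS; rewrite inE xf andbT eq_edges.
  by move: fX; rewrite in_setU1 => /predU1P[->|/setDP[]//]; move: ex; rewrite inE => /andP[].
have l2 := subset_leq_card sC.
move: eqV; rewrite (cardsD1 x' (vertices G')) xG' => eqV.
by clear -eqV cardI l1 l2 k_gt0; lia.
Qed.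

End Comparison.

(** * Reconstruction from stars and the final argument *)

Lemma del_vertex_hall (V E : finType) (G : graph V E) (x : V) :
  bowtie (del_vertex G x) ->
  hall G 1 (edges G :\: star G x) (vertices G :\ x).
Proof. by move/bowtieP; rewrite del_vertex_edges del_vertex_vertices. Qed.

(** Stars determine incidence, hence the ends of every edge. Distinct stars in G make the matching
    of vertices injective, and equal vertex counts make it bijective. *)
Lemma strongly_isomorphic_of_stars (V V' E : finType)
    (G : graph V E) (G' : graph V' E) :
  edges G = edges G' -> #|vertices G'| = #|vertices G| ->
  {in vertices G &, injective (star G)} ->
  (forall x, x \in vertices G ->
     exists2 x', x' \in vertices G' & star G' x' = star G x) ->
  stars G = stars G' /\ strongly_isomorphic G G'.
Proof.
move=> eqE eqV inj_star ex.
pose T := {x | x \in vertices G}; pose T' := {x' | x' \in vertices G'}.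
have exT (x : T) : exists x' : T', star G' (val x') == star G (val x).
  by have [x' x'G' sx'] := ex _ (valP x); exists (exist _ x' x'G'); apply/eqP.
pose nu x := xchoose (exT x).
have nuP x : star G' (val (nu x)) = star G (val x).
  exact/eqP/(xchooseP (exT x)).
have inj_nu : injective nu.
  move=> x y eq_nu; apply/val_inj/inj_star; try exact: valP.
  by rewrite -!nuP eq_nu.
have bij_nu : bijective nu by apply: inj_card_bij inj_nu _; rewrite !card_sig eqV.
have [mu _ muK] := bij_nu.
split.
  apply/setP => S; apply/imsetP/imsetP => [[x xG ->]|[x' x'G' ->]].
    by have [x' x'G' <-] := ex x xG; exists x'.
  exists (val (mu (exist _ x' x'G'))); first exact: valP.
  by rewrite -nuP muK.
split=> //; exists nu; split=> // e x y eG.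
have endsE z : (val (nu z) \in ends G' e) = (val z \in ends G e).
  by have /setP/(_ e) := nuP z; rewrite !inE -eqE eG.
have eG' : e \in edges G' by rewrite -eqE.
split=> eq_ends; apply/setP => z; rewrite !inE.
  have [zG'|nz] := boolP (z \in vertices G'); last first.
    rewrite (contraNF (subsetP (ends_vertices eG') z) nz).
    by apply/esym/norP; split; apply: contraNneq nz => ->; apply: valP.
  have -> : z = val (nu (mu (exist _ z zG'))) by rewrite muK.
  by rewrite endsE eq_ends !inE !(inj_eq val_inj) !(inj_eq inj_nu).
have [zG|nz] := boolP (z \in vertices G); last first.
  rewrite (contraNF (subsetP (ends_vertices eG) z) nz).
  by apply/esym/norP; split; apply: contraNneq nz => ->; apply: valP.
rewrite -(endsE (exist _ z zG)) eq_ends !inE !(inj_eq val_inj) !(inj_eq inj_nu).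
by rewrite -!(inj_eq val_inj).
Qed.

Theorem theorem6p3 (V V' E : finType) (G : graph V E) (G' : graph V' E)
    (k : nat) (v : V)
    (hk : 2 <= k)
    (hv : v \in vertices G)
    (hG' : forall x' : V', ~~ isolated G' x')
    (a1 : (k%:Z <= Delta G)%R /\ bowtie G)
    (a2 : forall x : V, x \in vertices G -> x <> v ->
            (k%:Z <= Delta (del_vertex G x))%R /\ bowtie (del_vertex G x))
    (a3 : forall p : E, is_loop G p -> p \in star G v)
    (a4 : ~~ big_vertex k G v /\ ~~ has_tree_component (del_vertex G v))
    (a5 : circular_matroid k G' = circular_matroid k G) :
  stars G = stars G' /\ strongly_isomorphic G G'.
Proof.
have k_gt0 : 0 < k by apply: leq_trans hk.
have eqE := eq_edges a5.
have [DG /bowtieP hG] := a1.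
have dG : #|vertices G| + k <= #|edges G| by move: DG; rewrite /Delta; clear; lia.
have endG : endset G (edges G) = vertices G.
  by apply/eqP; rewrite eqEsubset endset_vertices //= (hall_sub_endset hG).
have endG' : endset G' (edges G) = vertices G'.
  rewrite -eqE; apply/eqP; rewrite eqEsubset endset_vertices //=.
  apply/subsetP => x' x'G'; apply: contraR (hG' x') => nx'; rewrite /isolated x'G' /=.
  rewrite /deg addn_eq0 !cards_eq0; apply/andP; split; apply/set0Pn => -[e].
    rewrite inE => /andP[eG' xe]; case/negP: nx'.
    exact: (subsetP (ends_sub_endset _ eG')).
  rewrite inE => /andP[eG' /eqP xe]; case/negP: nx'.
  by apply: (subsetP (ends_sub_endset _ eG')); rewrite xe inE.
have eqV : #|vertices G'| = #|vertices G|.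
  apply/eqP; rewrite eqn_leq (vertices_card_le k_gt0 a5 endG hG dG) andbT.
  by rewrite -endG -endG' (endset_card_le k_gt0 a5) // endG.
have hall1 x : x \in vertices G -> x != v ->
    hall G 1 (edges G :\: star G x) (vertices G :\ x).
  by move=> xG /eqP xv; have [_] := a2 x xG xv; apply: del_vertex_hall.
have hall0 x : x \in vertices G -> x != v ->
    hall G 0 (edges G :\: star G x) (vertices G :\ x).
  by move=> xG xv; apply/hallW/hall1.
have dx x : x \in vertices G -> x != v ->
    #|vertices G :\ x| + k <= #|edges G :\: star G x|.
  move=> xG /eqP xv; have [] := a2 x xG xv.
  by rewrite /Delta del_vertex_edges del_vertex_vertices; clear; lia.
(* If x and y had the same star, deleting x would leave y without edges, against the Hall condition
   for G - x. *)
have star_neq x y : x \in vertices G -> y \in vertices G -> x != v -> y != x ->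
    star G x <> star G y.
  move=> xG yG xv yx eq_star.
  have yX : y \in vertices G :\ x by rewrite !inE yx.
  have /(leq_ltn_trans (leq0n _))/card_gt0P[e] := hall_incident (hall1 x xG xv) yX.
  by rewrite eq_star !inE => /andP[/andP[ny eG] ye]; rewrite eG ye in ny.
have inj_star : {in vertices G &, injective (star G)}.
  move=> x y xG yG eq_star; apply/eqP; apply: contraT => nxy.
  have [xv|xv] := eqVneq x v; last by case: (star_neq x y) => //; rewrite eq_sym.
  by case: (star_neq y x) => //; rewrite -xv eq_sym.
have ex_star x : x \in vertices G -> x != v ->
    exists2 x', x' \in vertices G' & star G' x' = star G x.
  move=> xG xv; set X := edges G :\: star G x.
  have sX : X \subset edges G := subsetDl _ _.
  have endX : endset G X = vertices G :\ x.
    apply/eqP; rewrite eqEsubset (hall_sub_endset (hall0 x xG xv)) andbT.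
    rewrite subsetD1 endset_vertices //=; apply/bigcupP => -[e].
    by rewrite !inE => /andP[ne eG] xe; rewrite eG xe in ne.
  have leX : #|endset G' X| <= #|endset G X|.
    by apply: (endset_card_le k_gt0 a5); rewrite ?endX //; [apply: hall1 | apply: dx].
  (* X spans at most |V| - 1 of the |V| vertices of G', so one is missed, and its star lies in
     S(x). *)
  have [x' x'G' nx'] : exists2 x', x' \in vertices G' & x' \notin endset G' X.
    apply/subsetPn; apply: contraL leX => /subset_leq_card leV; rewrite -ltnNge.
    by apply: leq_trans leV; rewrite endX eqV (cardsD1 x (vertices G)) xG.
  exists x' => //; apply: (star_eq k_gt0 a5) => //; first exact: hall0.
    have := dx x xG xv; have := cardsD1 x (vertices G); rewrite xG -/X.
    by clear; lia.
  apply/subsetP => e; rewrite inE eqE => /andP[eG xe].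
  apply: contraR nx' => ne; apply: (subsetP (ends_sub_endset G' (_ : e \in X))) xe.
  by rewrite inE ne.
apply: strongly_isomorphic_of_stars => // x xG.
have [->{x xG}|/(ex_star x xG)//] := eqVneq x v.
pose R x x' := (x' \in vertices G') && (star G' x' == star G x).
have exR (x : {x | x \in vertices G :\ v}) : exists x', R (val x) x'.
  have /setD1P[xv xG] := valP x.
  by have [x' x'G' sx'] := ex_star _ xG xv; exists x'; rewrite /R x'G' sx' eqxx.
pose f x := xchoose (exR x).
have fS x : star G' (f x) = star G (val x).
  by have /andP[_ /eqP] := xchooseP (exR x).
(* The image of f has at most |V| - 1 elements, so some vertex of G' is left to be matched with
   v. *)
have [v' v'G' nv'] : exists2 v', v' \in vertices G' & v' \notin f @: setT.
  apply/subsetPn; apply/negP => /subset_leq_card; apply/negP; rewrite -ltnNge eqV.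
  apply: leq_ltn_trans (leq_imset_card _ _) _; rewrite cardsT card_sig.
  by rewrite (cardsD1 v (vertices G)) hv add1n ltnS; apply/subset_leq_card/subsetP.
have [nbig notree] := a4.
have hallv : hall G 0 (edges G :\: star G v) (vertices G :\ v).
  by have := no_tree_component_hall notree; rewrite del_vertex_edges del_vertex_vertices.
exists v' => //; apply: (star_eq k_gt0 a5) => //.
  (* The rank is at least |V| + k - 1, and v not being k-big means |E - S(v)| >= rank - 1. This
     gives |V| + k - 2, precisely the slack allowed by [star_eq]. *)
  have hG0 : hall G 0 (edges G) (endset G (edges G)).
    by rewrite endG; apply: hallW.
  have [I [_ indI cardI]] := hall_indep k_gt0 (subxx _) hG0.
  have leI : #|I| <= rank (circular_matroid k G).
    exact: (leq_bigmax_cond (F := fun X : {set E} => #|X|) I indI).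
  have sS : star G v \subset edges G by apply/subsetP => e; rewrite inE => /andP[].
  move: nbig; rewrite /big_vertex -leqNgt /corank /= (cardsDS sS) => nbig.
  have leS := subset_leq_card sS; rewrite endG in cardI.
  by clear -nbig leI cardI dG k_gt0 leS; lia.
apply/subsetP => e; rewrite inE eqE => /andP[eG v'e].
apply: contraT => nev; have nloop : ~~ is_loop G e by apply: contra nev => /a3.
have card_e : #|ends G e| == 2.
  have := ends_card eG; move: nloop; rewrite /is_loop eG /=.
  by case: #|_| => [|[|[|]]].
have /cards2P[a [b [nab eab]]] := card_e.
have endX c : c \in [set a; b] -> c \in vertices G :\ v.
  rewrite -eab => ce; rewrite !inE (subsetP (ends_vertices eG)) // andbT.
  by apply: contraNneq nev => <-; rewrite inE eG.
pose a0 : {x | x \in vertices G :\ v} := exist _ a (endX a (set21 a b)).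
pose b0 : {x | x \in vertices G :\ v} := exist _ b (endX b (set22 a b)).
have f_end x : val x \in ends G e -> f x \in ends G' e.
  by move=> xe; have /setP/(_ e) := fS x; rewrite !inE eqE eG xe.
have f_neq x : f x != v' by apply: contraNneq nv' => <-; apply: imset_f.
have nfab : f a0 != f b0.
  apply: contraNneq nab => eqf; apply/eqP; apply: inj_star.
  - by have /setD1P[] := endX a (set21 a b).
  - by have /setD1P[] := endX b (set22 a b).
  by rewrite -[a]/(val a0) -[b]/(val b0) -!fS eqf.
(* An edge at v' that avoids v would have three distinct ends in G'. *)
have : #|[set f a0; f b0; v']| <= 2.
  apply: leq_trans (_ : #|ends G' e| <= 2); last first.
    by have /ends_card/andP[] : e \in edges G' by rewrite eqE.
  rewrite subset_leq_card // !subUset !sub1set v'e.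
  by rewrite !f_end //= eab !inE eqxx ?orbT.
by rewrite setUC cardsU1 cards2 nfab !inE ![v' == _]eq_sym (negPf (f_neq _)) (negPf (f_neq _)).
Qed.
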